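(* Let $\mathcal{H}$ be a complex Hilbert space and let $S,T\in\mathcal{L}(\mathcal{H})$ have closed ranges and satisfy $S\overset{*}{\leq}T$. Let $S=U_S-W$ and $T=U_T-V$ be the polar proper splittings of $S$ and $T$, respectively. If the polar proper splitting of $T$ converges, then the polar proper splitting of $S$ converges. Moreover, $\rho(U_S^*W)\leq\rho(U_T^*V)$. In addition, the polar proper splitting of $S$ is obtained from that of $T$ as $S=P_SU_T-P_SV$ (that is, $U_S=P_SU_T$ and $W=P_SV$).
   Context: $\mathcal{L}(\mathcal{H})$ is the algebra of bounded linear operators on $\mathcal{H}$; $\rho$ is the spectral radius. $P_S$ is the orthogonal projection onto $\mathcal{R}(S)$. Star order: $S\overset{*}{\leq}T$ if there exist orthogonal projections $P,Q$ with $S=PT$ and $S^*=QT^*$ (one may choose $P,Q$ to be the orthogonal projections onto $\overline{\mathcal{R}(S)}$ and $\overline{\mathcal{R}(S^* )}$). $T=U_T|T|$ is the polar decomposition, with $|T|=(T^*T)^{1/2}$ and $U_T$ the partial isometry with $\mathcal{N}(U_T)=\mathcal{N}(T)$. The polar proper splitting of a closed range operator $T$ is $T=U_T-V$, i.e. $V=U_T-T$; it converges if $\rho(U_T^*V)<1$. *)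

(* Defs.v *)
From HB Require Import structures.
From mathcomp Require Import all_boot all_order all_algebra.
From mathcomp Require Import sesquilinear complex.
From mathcomp Require Import all_classical all_reals all_analysis.
Import Order.TTheory GRing.Theory Num.Theory.
Import numFieldNormedType.Exports.

Set Implicit Arguments.
Unset Strict Implicit.
Unset Printing Implicit Defensive.

Local Open Scope complex_scope.
Local Open Scope classical_set_scope.
Local Open Scope ring_scope.

(* {dot H for Num.conj} is the type of positive definite forms that are linear in
   the first argument and conjugate-linear in the second. *)
HB.mixin Record CompleteNormedModule_isHilbert (R : realType) H
    of CompleteNormedModule R[i] H := {
  inner : {dot H for (@Num.conj R[i])} ;
  normr_inner : forall x : H, `|x| ^+ 2 = inner x x
}.

#[short(type="hilbertType")]
HB.structure Definition Hilbert (R : realType) :=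
  {H of CompleteNormedModule R[i] H & CompleteNormedModule_isHilbert R H}.

Section operators.
Context {R : realType} {H : hilbertType R}.
Implicit Types (A B P S T U V : H -> H) (M : set H).

Notation "'[ x , y ]" := (inner x y) : ring_scope.

(* The set L(H); operators are plain functions, so that sums, products and
   equality are those of functions. *)
Definition bounded_op : set (H -> H) := [set T | linear T /\ continuous T].

Definition kernel T : set H := [set x | T x = 0].

(* Riesz representation yields exactly one A as below for T in L(H); the value
   at other T is irrelevant. *)
Definition adjoint T : H -> H :=
  xget (cst 0) [set A | bounded_op A /\ forall x y, '[T x, y] = '[x, A y]].

Definition orthogonal_projection P : Prop :=
  [/\ bounded_op P, P \o P = P & adjoint P = P].

(* P_M, for a closed subspace M *)
Definition proj_onto M : H -> H :=
  xget (cst 0) [set P | orthogonal_projection P /\ range P = M].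

Definition star_le S T : Prop :=
  exists P Q, [/\ orthogonal_projection P, orthogonal_projection Q,
    S = P \o T & adjoint S = Q \o adjoint T].

(* In R[i], 0 <= z means that z is real and nonnegative. *)
Definition positive_op A : Prop :=
  bounded_op A /\ forall x, 0 <= '[A x, x].

(* A = |T| = (T^* T)^(1/2); the positive square root of a positive operator
   exists and is unique. *)
Definition is_modulus T A : Prop :=
  positive_op A /\ A \o A = adjoint T \o T.

Definition partial_isometry U : Prop :=
  bounded_op U /\
  forall x, (forall y, kernel U y -> '[x, y] = 0) -> `|U x| = `|x|.

(* U = U_T, the partial isometry of the polar decomposition T = U_T |T| *)
Definition is_polar_isometry T U : Prop :=
  [/\ partial_isometry U, kernel U = kernel T &
    exists2 A, is_modulus T A & T = U \o A].

Definition polar_proper_splitting T U V : Prop :=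
  is_polar_isometry T U /\ V = U \- T.

Definition spectrum A : set R[i] :=
  [set l | ~ exists2 B, bounded_op B &
    B \o (l \*: id \- A) = id /\ (l \*: id \- A) \o B = id].

(* The modulus of a complex number is a nonnegative real in R[i], whence Re.
   The spectrum is bounded, and nonempty unless H is trivial; in that case the
   radius is sup set0 = 0. *)
Definition spectral_radius A : R :=
  sup [set complex.Re `|l| | l in spectrum A].

Definition splitting_converges U V : Prop :=
  spectral_radius (adjoint U \o V) < 1.

End operators.

(* Main.v *)
(** Let A_S = |S|, A_T = |T|, let P be the projection onto R(S) and let
    Q = U_S^* U_S be the projection onto the orthogonal complement of N(S). The
    star order gives S = P T = T Q, hence A_S^2 = A_T^2 Q, and uniqueness of
    positive square roots gives A_S = A_T Q = Q A_T. An operator that vanishes on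
    R(|T|) and on N(T) is zero; applied to U_T Q - U_S and to P U_T - U_S this
    yields the formulas for U_S and W. Finally U_S^* W = Q - A_S = M Q, where
    M = U_T^* V = U_T^* U_T - A_T commutes with Q, so that the spectrum of U_S^* W
    lies in the spectrum of M together with 0. *)
From HB Require Import structures.
Require Import Defs.
From mathcomp Require Import all_boot all_order all_algebra.
From mathcomp Require Import all_classical all_reals all_analysis.
From mathcomp Require Import sesquilinear complex ring.
Import numFieldNormedType.Exports.
Import Order.TTheory GRing.Theory Num.Theory.
Local Open Scope classical_set_scope.
Local Open Scope ring_scope.

Set Implicit Arguments.
Unset Strict Implicit.
Unset Printing Implicit Defensive.

Section hilbert_space.
Context {R : realType} {H : hilbertType R}.
Implicit Types (x y z u v w : H) (a b : R[i]) (A B E P Q S T U V : H -> H).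

Local Notation "''[' x , y ]" := (inner x y) : ring_scope.

(** * Inner product identities and the Cauchy-Schwarz inequality *)

Lemma innerZl a x y : '[a *: x, y] = a * '[x, y].
Proof. by rewrite linearZl_LR. Qed.

Lemma innerZr a x y : '[x, a *: y] = a^* * '[x, y].
Proof. by rewrite linearZr_LR. Qed.

Lemma innerDl x y z : '[x + y, z] = '[x, z] + '[y, z].
Proof. by rewrite linearDl. Qed.

Lemma innerDr x y z : '[z, x + y] = '[z, x] + '[z, y].
Proof. by rewrite linearDr. Qed.

Lemma innerBl x y z : '[x - y, z] = '[x, z] - '[y, z].
Proof. by rewrite linearBl. Qed.

Lemma innerBr x y z : '[z, x - y] = '[z, x] - '[z, y].
Proof. by rewrite linearBr. Qed.

Lemma innerC x y : '[y, x] = '[x, y]^*.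
Proof. by rewrite hermC /= expr0 mul1r. Qed.

Lemma inner_eq0C x y : '[x, y] = 0 -> '[y, x] = 0.
Proof. by move=> xy; rewrite innerC xy conjC0. Qed.

Lemma inner_eq0 x : (forall y, '[x, y] = 0) -> x = 0.
Proof. by move=> /(_ x) /eqP; rewrite dnorm_eq0 => /eqP. Qed.

Lemma innerI x y : (forall z, '[z, x] = '[z, y]) -> x = y.
Proof.
move=> xy; apply/subr0_eq/inner_eq0 => z; apply: inner_eq0C.
by rewrite innerBr xy subrr.
Qed.

(** With [a = <w, n> / <n, n>], the vector [a *: n] is the point of the line through [n] nearest to
    [w]. Only the resulting value matters: it gives both Cauchy-Schwarz and the estimate for
    near-minimisers of the distance to a subspace. *)
Lemma inner_complete_square w n : n != 0 ->
  exists a, '[w - a *: n, w - a *: n] = '[w, w] - `|'[w, n]| ^+ 2 / '[n, n].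
Proof.
move=> n0; exists ('[w, n] / '[n, n]).
have nn : '[n, n] != 0 by rewrite dnorm_eq0.
rewrite dnormB dnormZ innerZr normrM exprMn rmorphM fmorphV /=.
have nr : '[n, n]^* = '[n, n] by rewrite -innerC.
rewrite nr normfV (ger0_norm (dnorm_ge0 _ _)) normCK.
rewrite !rmorphM/= fmorphV/= nr conjCK.
by field.
Qed.

Lemma inner_norm x y : `|'[x, y]| <= `|x| * `|y|.
Proof.
have [->|y0] := eqVneq y 0; first by rewrite linear0r normr0 mulr_ge0.
rewrite -(ler_pXn2r (n := 2)) ?nnegrE ?mulr_ge0// exprMn !normr_inner.
have [a e] := inner_complete_square x y0.
by move: (dnorm_ge0 (@inner R H) (x - a *: y)); rewrite e subr_ge0
  ler_pdivrMr ?dnorm_gt0.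
Qed.

(** A positive element of [R[i]] is real, so the Archimedean property of [R] carries over through
    [Re]. *)
Lemma near_natSinv_lt (e : R[i]) : 0 < e ->
  \forall n \near \oo, n.+1%:R^-1 < e.
Proof.
move=> e0; have er : (complex.Re e)%:C%C = e by apply/RRe_real/gtr0_real.
have e1 : 0 < complex.Re e by rewrite -ltcR er.
apply: filterS (near_infty_natSinv_lt (PosNum e1)) => n /=.
by rewrite -ltcR er fmorphV /= rmorph_nat.
Qed.

Lemma cvg_of_dist (u : nat -> H) (c : R[i]) : 0 < c ->
  (forall j k, `|u j - u k| <= c * (j.+1%:R^-1 + k.+1%:R^-1)) ->
  exists l : H, u @ \oo --> l.
Proof.
move=> c0 uc; apply/cvg_ex/cauchy_cvgP/cauchy_ballP => e e0.
have e1 : 0 < e / c / 2 by rewrite !divr_gt0.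
rewrite near_map2; near=> j k.
rewrite -ball_normE /= (le_lt_trans (uc _ _))// mulrC -ltr_pdivlMr//.
rewrite [ltRHS]splitr ltrD//; [near: j|near: k]; exact: near_natSinv_lt.
Unshelve. all: by end_near. Qed.

(** * Projection onto a closed subspace *)

Definition subspace (M : set H) :=
  M !=set0 /\ forall a x y, M x -> M y -> M (a *: x + y).

Lemma subspace0 M : subspace M -> M 0.
Proof.
move=> [[x Mx] lM]; have := lM (-1) x x Mx Mx.
by rewrite scaleN1r addNr.
Qed.

Lemma subspaceB M x y : subspace M -> M x -> M y -> M (x - y).
Proof. by move=> sM Mx My; rewrite addrC -scaleN1r; apply: sM.2. Qed.

(** Take [m] whose squared distance to [x] is within [e ^+ 2] of the infimum. A move from [m] along
    [n] can lower the squared distance by [|<x - m, n>|^2 / <n, n>], which is therefore at most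
    [e ^+ 2]. *)
Lemma almost_projection M x (e : R) : subspace M -> 0 < e ->
  exists2 m, M m & forall n, M n -> `|'[x - m, n]| <= e%:C%C * `|n|.
Proof.
move=> sM e0.
pose D := [set complex.Re '[x - m, x - m] | m in M].
have RD z : (complex.Re '[z, z])%:C%C = '[z, z].
  by apply/RRe_real/ger0_real/dnorm_ge0.
have lbD : lbound D 0.
  by move=> _ [m _ <-]; rewrite -lecR RD dnorm_ge0.
have iD : has_inf D.
  split; last by exists 0.
  by exists (complex.Re '[x - 0, x - 0]); exists 0 => //; exact: subspace0.
have [_ [m Mm <-] Dm] := @inf_adherent _ D (e ^+ 2) ltac:(by rewrite exprn_gt0) iD.
exists m => // n Mn.
have [->|n0] := eqVneq n 0; first by rewrite linear0r !normr0 mulr0.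
have [a ea] := inner_complete_square (x - m) n0.
have : (inf D)%:C%C <= '[x - m - a *: n, x - m - a *: n].
  rewrite -RD lecR; apply: ge_inf; first by exists 0.
  exists (m + a *: n); last by rewrite opprD addrA.
  by rewrite addrC; exact: sM.2.
rewrite ea lerBrDr => le_inf.
have ec : 0 <= e%:C%C by rewrite ler0c ltW.
rewrite -(ler_pXn2r (n := 2)) ?nnegrE ?mulr_ge0//.
rewrite exprMn normr_inner -ler_pdivrMr ?dnorm_gt0//.
rewrite -(lerD2l (inf D)%:C%C) (le_trans le_inf)// -RD -rmorphXn -rmorphD.
by rewrite lecR ltW.
Qed.

(** Near-projections [u k] with error [1 / (k + 1)] form a Cauchy sequence: the difference
    [u j - u k] lies in [M], so the two near-orthogonality bounds can be tested on it. Orthogonality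
    passes to the limit. *)
Lemma projection_theorem M x : subspace M -> closed M ->
  exists2 m, M m & forall n, M n -> '[x - m, n] = 0.
Proof.
move=> sM cM.
have /choice[u uM] : forall k : nat, exists m, M m /\
    forall n, M n -> `|'[x - m, n]| <= k.+1%:R^-1 * `|n|.
  move=> k; have k0 : (0 : R) < k.+1%:R^-1 by [].
  have [m Mm mn] := almost_projection x sM k0; exists m; split => // n /mn.
  by rewrite fmorphV rmorph_nat.
have [|l ul] := @cvg_of_dist u 1 ltr01.
  move=> j k; rewrite mul1r; set n := u j - u k.
  have Mn : M n by apply: subspaceB => //; apply: (uM _).1.
  have [->|n0] := eqVneq n 0; first by rewrite normr0 addr_ge0.
  rewrite -(ler_pM2r (x := `|n|)) ?normr_gt0// -expr2 normr_inner.
  have -> : '[n, n] = '[x - u k, n] - '[x - u j, n].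
    by rewrite -innerBl; congr '[_, _]; rewrite /n opprB [RHS]addrC subrKA.
  rewrite -[leLHS]ger0_norm; last first.
    by rewrite -innerBl opprB [x - u k + _]addrC subrKA dnorm_ge0.
  rewrite (le_trans (ler_normB _ _))// mulrDl addrC lerD//; exact: (uM _).2.
exists l; first by apply: closed_cvg ul => //; apply: nearW => k; exact: (uM k).1.
move=> n Mn; have [->|n0] := eqVneq n 0; first by rewrite linear0r.
apply/eqP; rewrite -normr_le0; apply/ler_addgt0Pl => e e0; rewrite addr0.
have e1 : 0 < e / `|n| / 2 by rewrite !divr_gt0 ?normr_gt0.
near \oo => k.
have -> : '[x - l, n] = '[x - u k, n] - '[l - u k, n].
  by rewrite -innerBl opprB addrA subrK.
rewrite (le_trans (ler_normB _ _))//.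
rewrite (le_trans (lerD ((uM k).2 _ Mn) (inner_norm _ _)))//.
rewrite -mulrDl -ler_pdivlMr ?normr_gt0// [leRHS]splitr lerD//; apply: ltW.
  by near: k; exact: near_natSinv_lt.
by near: k; move/cvgrPdist_lt : ul => /(_ _ e1).
Unshelve. all: by end_near. Qed.

Lemma inner_continuous y : continuous (fun x => '[x, y]).
Proof.
move=> x; have [->|y0] := eqVneq y 0.
  by under eq_fun do rewrite linear0r; exact: cvg_cst.
apply/cvgrPdist_lt => e e0; near=> z.
rewrite -innerBl (le_lt_trans (inner_norm _ _))// -ltr_pdivlMr ?normr_gt0//.
by near: z; apply: cvgr_dist_lt => //; rewrite divr_gt0 ?normr_gt0.
Unshelve. all: by end_near. Qed.

Lemma closed_inner_eq0 (f : H -> H) y : continuous f ->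
  closed [set x | '[f x, y] = 0].
Proof.
move=> cf; apply: (@closed_comp _ _ (fun x => '[f x, y]) [set 0]).
  move=> x _; apply: (@continuous_comp _ _ _ f (fun z => '[z, y])).
    exact: cf.
  exact: inner_continuous.
exact/accessible_closed_set1/hausdorff_accessible/norm_hausdorff.
Qed.

(** * Bounded operators and their adjoints *)

Lemma bounded_op_linear T : bounded_op T ->
  exists2 f : {linear H -> H}, continuous f & T = f.
Proof.
move=> [lT cT].
pose f : {linear H -> H} := HB.pack T (GRing.isLinear.Build _ _ _ _ _ lT).
by exists f.
Qed.

Lemma bounded_op_bound T : bounded_op T ->
  exists2 c : R[i], 0 < c & forall x, `|T x| <= c * `|x|.
Proof.
move=> /bounded_op_linear[f cf ->].
move/linear_bounded_continuous/linear_boundedP : cf => /pinfty_ex_gt0[c c0 cf].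
by exists c.
Qed.

Lemma bound_bounded_op T (c : R[i]) : linear T -> (forall x, `|T x| <= c * `|x|) ->
  bounded_op T.
Proof.
move=> lT cT; split=> //.
pose f : {linear H -> H} := HB.pack T (GRing.isLinear.Build _ _ _ _ _ lT).
apply: (@bounded_linear_continuous _ _ _ f).
(* The constant [c] is an arbitrary element of [R[i]], so its modulus serves as the bound on the
   unit ball. *)
apply/ex_bound; exists `|c|; apply/nbhs_norm0P; exists 1 => //= x /= x1.
rewrite (le_trans (cT x))// (le_trans (real_ler_norm _))//.
  by apply: ger0_real; apply: le_trans (cT x).
by rewrite normrM normr_id ler_piMr// ltW.
Qed.

(** The functional [x |-> <T x, y>] has a closed kernel [K]. If it is not all of [H], a vector [z]
    orthogonal to [K] with nonzero value represents the functional after scaling, since subtracting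
    a suitable multiple of [z] sends any [x] into [K]. *)
Lemma riesz T y : bounded_op T -> exists z, forall x, '[T x, y] = '[x, z].
Proof.
move=> /bounded_op_linear[f cf ->].
pose K := [set x | '[f x, y] = 0].
have sK : subspace K.
  split; first by exists 0; rewrite /K /= linear0 linear0l.
  move=> a u v; rewrite /K /= => Ku Kv.
  by rewrite (linearP f) innerDl/= innerZl Ku Kv mulr0 addr0.
have cK : closed K by exact: closed_inner_eq0.
have [fK|/existsNP[x0 Kx0]] := pselect (forall x, K x).
  by exists 0 => x; rewrite linear0r; exact: fK.
have [m Km orth] := projection_theorem x0 sK cK.
set z := x0 - m in orth.
have fz : '[f z, y] != 0.
  by apply/eqP; rewrite /z (linearB f) innerBl Km subr0.
have zz : '[z, z] != 0.
  by rewrite dnorm_eq0; apply: contra_neq fz => ->; rewrite linear0 linear0l.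
exists (('[f z, y] / '[z, z])^* *: z) => x; rewrite innerZr conjCK.
pose r := '[f x, y] / '[f z, y].
have /orth/inner_eq0C : K (x - r *: z).
  by rewrite /K /= (linearB f) innerBl (linearZ_LR f)/= innerZl divfK// subrr.
rewrite innerBl/= innerZl => /subr0_eq ->.
by rewrite /r; field; rewrite zz fz.
Qed.

(** Any bound [c] of [T] also bounds [A], because [|A x|^2 = <T (A x), x> <= c |A x| |x|]. *)
Lemma adjoint_exists T : bounded_op T ->
  exists A, bounded_op A /\ forall x y, '[T x, y] = '[x, A y].
Proof.
move=> bT; have /choice[A TA] : forall y, exists z, forall x, '[T x, y] = '[x, z].
  by move=> y; exact: riesz.
exists A; split=> //; have [c c0 cT] := bounded_op_bound bT.
apply: (@bound_bounded_op _ c) => [a x y|x].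
  by apply: innerI => z; rewrite -TA !innerDr/= !innerZr -!TA.
have [->|A0] := eqVneq (A x) 0; first by rewrite normr0 mulr_ge0// ltW.
rewrite -(ler_pM2l (x := `|A x|)) ?normr_gt0// -expr2 normr_inner -TA.
rewrite -[leLHS]ger0_norm ?TA ?dnorm_ge0// -TA (le_trans (inner_norm _ _))//.
by rewrite mulrA [`|A x| * c]mulrC ler_wpM2r.
Qed.

Lemma adjoint_bounded T : bounded_op T -> bounded_op (adjoint T).
Proof. by move=> /adjoint_exists/(xgetPex (cst 0))[]. Qed.

Lemma adjointE T x y : bounded_op T -> '[T x, y] = '[x, adjoint T y].
Proof. by move=> /adjoint_exists/(xgetPex (cst 0))[]. Qed.

Lemma adjointE' T x y : bounded_op T -> '[adjoint T x, y] = '[x, T y].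
Proof. by move=> bT; rewrite innerC -adjointE// -innerC. Qed.

Lemma adjoint_unique T A : bounded_op T -> (forall x y, '[T x, y] = '[x, A y]) ->
  adjoint T = A.
Proof.
move=> bT TA; apply/funext => y; apply: innerI => x.
by rewrite -TA adjointE.
Qed.

Lemma bounded_op_comp A B : bounded_op A -> bounded_op B -> bounded_op (A \o B).
Proof.
move=> /bounded_op_linear[f cf ->] /bounded_op_linear[g cg ->]; split.
  by move=> a x y; rewrite /= !linearP.
by move=> x; apply: continuous_comp; [exact: cg|exact: cf].
Qed.

Lemma bounded_op_lin A B a b : bounded_op A -> bounded_op B ->
  bounded_op (fun x => a *: A x + b *: B x).
Proof.
move=> bA bB; have [c c0 Ac] := bounded_op_bound bA.
have [d d0 Bd] := bounded_op_bound bB.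
apply: (@bound_bounded_op _ (`|a| * c + `|b| * d)) => [k x y|x].
  case: bA bB => + _ [+ _] => -> ->; rewrite !scalerDr !scalerA.
  by rewrite addrACA ![k * _]mulrC.
rewrite (le_trans (ler_normD _ _))// mulrDl !normrZ -!mulrA.
by rewrite lerD// ler_wpM2l.
Qed.

Lemma bounded_op_id : bounded_op (@id H).
Proof. by split=> // x; exact: cvg_id. Qed.

Lemma bounded_op_sub A B : bounded_op A -> bounded_op B -> bounded_op (A \- B).
Proof.
move=> bA bB; have := bounded_op_lin 1 (-1) bA bB.
by congr bounded_op; apply/funext => x /=; rewrite scale1r scaleN1r.
Qed.

(** Polarisation over complex scalars: [x + y] shows that [<A x, y>] and [<A y, x>] are opposite,
    [x + 'i *: y] that they are equal. *)
Lemma bounded_op_eq0 A : bounded_op A -> (forall x, '[A x, x] = 0) ->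
  forall x, A x = 0.
Proof.
move=> /bounded_op_linear[f _ ->] fx0 x; apply: inner_eq0 => y.
have e1 : '[f x, y] + '[f y, x] = 0.
  have := fx0 (x + y).
  by rewrite (linearD f) innerDl !innerDr/= !fx0 add0r addr0.
have e2 : '[f y, x] = '[f x, y].
  have := fx0 (x + 'i *: y).
  rewrite (linearD f) (linearZ_LR f)/= innerDl !innerDr !innerZr !innerZl !fx0.
  rewrite !mulr0 add0r addr0 conjCi mulNr addrC => /subr0_eq.
  exact: mulfI (neq0Ci _) _ _.
by move: e1; rewrite e2 -mulr2n => /eqP; rewrite mulrn_eq0 => /eqP.
Qed.

(** * Positive operators *)

Lemma positive_op_sym A x y : positive_op A -> '[A x, y] = '[x, A y].
Proof.
move=> [bA A0]; rewrite adjointE//; congr '[_, _].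
apply/esym/subr0_eq.
(* The quadratic form of [A - A^*] vanishes because that of [A] is real. *)
apply: (bounded_op_eq0 (A := A \- adjoint A)).
  exact/bounded_op_sub/adjoint_bounded.
move=> z /=; rewrite innerBl/= adjointE'// [X in _ - X]innerC.
by rewrite geC0_conj// subrr.
Qed.

(** Positivity of [A] at [x - k^-1 *: A x], expanded, gives the claim once
    [<A (A x), A x> <= k |A x|^2] is inserted. *)
Lemma positive_op_norm_sqr A (k : R[i]) x : positive_op A -> 0 < k ->
  (forall y, `|A y| <= k * `|y|) -> `|A x| ^+ 2 <= k * '[A x, x].
Proof.
move=> pA k0 kA; set y := A x.
have := pA.2 (x - k^-1 *: y).
have /bounded_op_linear[f _ fE] := pA.1.
have kr : (k^-1)^* = k^-1 by rewrite geC0_conj// invr_ge0 ltW.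
rewrite fE (linearB f) (linearZ_LR f)/= -fE -/y.
rewrite innerBl/= !innerBr/= !innerZl !innerZr kr.
rewrite (positive_op_sym y x pA) -/y -normr_inner.
have : '[A y, y] <= k * `|y| ^+ 2.
  have yn : '[A y, y] <= `|'[A y, y]| by rewrite ger0_norm ?pA.2.
  rewrite (le_trans yn)// (le_trans (inner_norm _ _))//.
  by rewrite expr2 mulrA ler_wpM2r.
move: '[A y, y] '[y, x] (`|y| ^+ 2) => q p n qn.
have -> : p - k^-1 * n - (k^-1 * n - k^-1 * (k^-1 * q)) =
  k^-1 * (k * p - n - (n - k^-1 * q)) by field; rewrite gt_eqF.
rewrite pmulr_rge0 ?invr_gt0// subr_ge0 => h.
by rewrite -subr_ge0 (le_trans _ h)// subr_ge0 ler_pdivrMl.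
Qed.

Lemma positive_op_eq0 A x : positive_op A -> '[A x, x] = 0 -> A x = 0.
Proof.
move=> pA Ax; have [k k0 kA] := bounded_op_bound pA.1.
apply/eqP; rewrite -normr_eq0 -sqrf_eq0; apply/eqP/le_anti.
by rewrite exprn_ge0// andbT -(mulr0 k) -Ax positive_op_norm_sqr.
Qed.

(* With [t] small, [(1 + t A)^n X = X (1 - t B)^n]: the right-hand side stays
   bounded, while [|(1 + t A)^n z|^2 >= 2 n t <A z, z>]. *)
Lemma sylvester_eq0 A B X x : positive_op A -> positive_op B -> bounded_op X ->
  (forall y, A (X y) = - X (B y)) -> A (X x) = 0.
Proof.
move=> pA pB bX AX; have [k k0 kB] := bounded_op_bound pB.1.
have [c c0 cX] := bounded_op_bound bX.
have /bounded_op_linear[h _ hE] := bX.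
have /bounded_op_linear[a _ aE] := pA.1.
(* This step size makes [g = 1 - t B] a contraction: [t |B y|^2 <= <B y, y>]. *)
pose t := k^-1; have t0 : 0 < t by rewrite invr_gt0.
have tr : t^* = t by rewrite geC0_conj// ltW.
pose f z := z + t *: A z; pose g y := y - t *: B y.
have fX y : f (X y) = X (g y).
  by rewrite /f /g AX hE (linearB h) (linearZ_LR h)/= scalerN.
have fnX n y : iter n f (X y) = X (iter n g y).
  by elim: n => //= n ->; rewrite fX.
have gle y : `|g y| <= `|y|.
  rewrite -(ler_pXn2r (n := 2)) ?nnegrE// !normr_inner.
  rewrite innerBl !innerBr/= !innerZl !innerZr tr.
  rewrite -(positive_op_sym y y pB) -[leRHS]subr0 -addrA lerD2l.
  rewrite -opprD lerN2 addrA.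
  have := positive_op_norm_sqr y pB k0 kB; rewrite normr_inner => Bk.
  rewrite subr_ge0 (le_trans (y := t * '[B y, y]))//; last first.
    by rewrite lerDl mulr_ge0 ?(ltW t0) ?pB.2.
  by rewrite ler_wpM2l ?(ltW t0)// /t ler_pdivrMl.
have gnle n y : `|iter n g y| <= `|y|.
  by elim: n => //= n; apply: le_trans; exact: gle.
(* The form of [A] does not decrease along iterates of [f], so every iteration adds at least [2 t p]
   to the squared norm. *)
have fA z : '[A z, z] <= '[A (f z), f z].
  have -> : A (f z) = A z + t *: A (A z) by rewrite /f aE (linearD a) (linearZ_LR a).
  rewrite /f innerDl !innerDr/= !innerZl !innerZr tr.
  rewrite (positive_op_sym (A z) z pA) -addrA lerDl.
  by rewrite !addr_ge0// !mulr_ge0 ?dnorm_ge0 ?pA.2 ?(ltW t0).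
have fle z : `|z| ^+ 2 + (t * '[A z, z]) *+ 2 <= `|f z| ^+ 2.
  rewrite !normr_inner /f innerDl !innerDr/= !innerZl !innerZr tr.
  rewrite -(positive_op_sym z z pA) mulr2n !addrA lerDl.
  by rewrite !mulr_ge0 ?dnorm_ge0 ?(ltW t0).
set z := X x; set p := '[A z, z].
have grow n : p <= '[A (iter n f z), iter n f z] /\
    (t * p) *+ 2 *+ n <= `|iter n f z| ^+ 2.
  elim: n => [|n [ihp ihn]] /=; first by rewrite lexx mulr0n exprn_ge0.
  split; first exact: le_trans (fA _).
  rewrite (le_trans _ (fle _))// mulrS addrC lerD// lerMn2r/=.
  by rewrite ler_wpM2l// ltW.
have bd n : (t * p) *+ 2 *+ n <= (c * `|x|) ^+ 2.
  rewrite (le_trans (grow n).2)// fnX lerXn2r ?nnegrE ?mulr_ge0 ?(ltW c0)//.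
  by rewrite (le_trans (cX _))// ler_wpM2l// ltW.
apply: positive_op_eq0 => //; apply/eqP; rewrite -/p.
have p0 : 0 <= p by exact: pA.2.
apply: contraT => pn0; have {}p0 : 0 < p by rewrite lt_def pn0.
set C := _ ^+ 2 in bd.
(* The bound [C] may be zero; [C + 1] is a safe divisor. *)
have C0 : 0 < C + 1 by rewrite ltr_wpDl// exprn_ge0// mulr_ge0// ltW.
have e0 : 0 < (t * p) *+ 2 / (C + 1) by rewrite divr_gt0// pmulrn_lgt0// mulr_gt0.
near \oo => n.
have : n.+1%:R^-1 < (t * p) *+ 2 / (C + 1) by near: n; exact: near_natSinv_lt.
rewrite ltr_pdivlMr// ltr_pdivrMl ?ltr0Sn// mulr_natl => lt_C.
by have := lt_le_trans lt_C (bd n.+1); rewrite gtrDl ltr10.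
Unshelve. all: by end_near. Qed.

(** * Orthogonal projections *)

Lemma orthogonal_projection_sym P x y : orthogonal_projection P ->
  '[P x, y] = '[x, P y].
Proof. by move=> [bP _ aP]; rewrite adjointE// aP. Qed.

Lemma orthogonal_projectionK P x : orthogonal_projection P -> P (P x) = P x.
Proof. by move=> [_ PP _]; rewrite -[in RHS]PP. Qed.

Lemma orthogonal_projection_range P x : orthogonal_projection P ->
  range P x -> P x = x.
Proof. by move=> oP [y _ <-]; rewrite orthogonal_projectionK. Qed.

(** The orthogonal decomposition along [M] is unique ([Peq]), so the chosen points depend linearly
    on [x]; symmetry and the bound 1 follow from [<P x, y> = <P x, P y>]. *)
Lemma orthogonal_projection_exists M : subspace M -> closed M ->
  exists P, orthogonal_projection P /\ range P = M.
Proof.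
move=> sM cM.
have /choice[P PM] : forall x, exists m, M m /\ forall n, M n -> '[x - m, n] = 0.
  by move=> x; have [m Mm mn] := projection_theorem x sM cM; exists m.
have Peq x m : M m -> (forall n, M n -> '[x - m, n] = 0) -> P x = m.
  move=> Mm orth; apply/subr0_eq/eqP; rewrite -(dnorm_eq0 (@inner R H)); apply/eqP.
  have Md : M (P x - m) by apply: subspaceB => //; exact: (PM x).1.
  rewrite [X in '[X, _]](_ : _ = (x - m) - (x - P x)); last first.
    by rewrite opprB [RHS]addrC subrKA.
  by rewrite innerBl orth// (PM x).2// subrr.
have Pid x : M x -> P x = x.
  by move=> Mx; apply: Peq => // n _; rewrite subrr linear0l.
have Pinner x y : '[P x, y] = '[P x, P y].
  by apply/subr0_eq; rewrite -innerBr; apply/inner_eq0C/(PM y).2/(PM x).1.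
have lP : linear P.
  move=> a x y; apply: Peq; first by apply: sM.2; [exact: (PM x).1|exact: (PM y).1].
  move=> n Mn; rewrite opprD addrACA -scalerBr innerDl innerZl.
  by rewrite (PM x).2// (PM y).2// mulr0 addr0.
have Psym x y : '[P x, y] = '[x, P y].
  by rewrite Pinner [RHS]innerC [in RHS]Pinner -innerC.
have bP : bounded_op P.
  apply: (@bound_bounded_op _ 1) => // x; rewrite mul1r.
  have [->|P0] := eqVneq (P x) 0; first by rewrite normr0.
  rewrite -(ler_pM2r (x := `|P x|)) ?normr_gt0// -expr2 normr_inner.
  rewrite -[leLHS]ger0_norm ?dnorm_ge0//.
  by rewrite Psym Pid ?inner_norm//; exact: (PM x).1.
exists P; split.
  split=> //; last exact: adjoint_unique.
  by apply/funext => x /=; apply: Pid; exact: (PM x).1.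
apply/seteqP; split=> [_ [x _ <-]|x Mx]; first exact: (PM x).1.
by exists x => //; exact: Pid.
Qed.

Lemma range_subspace T : bounded_op T -> subspace (range T).
Proof.
move=> /bounded_op_linear[f _ ->]; split; first by exists (f 0); exists 0.
by move=> a _ _ [x _ <-] [y _ <-]; exists (a *: x + y); rewrite ?linearP.
Qed.

Lemma proj_ontoP T : bounded_op T -> closed (range T) ->
  orthogonal_projection (proj_onto (range T)) /\
  range (proj_onto (range T)) = range T.
Proof.
move=> bT cT.
exact: (xgetPex (cst 0) (orthogonal_projection_exists (range_subspace bT) cT)).
Qed.

(** [E] projects onto the orthogonal complement of [N(T)]; it is built as [id \- P] with [P] the
    projection onto [N(T)]. *)
Lemma kernel_projection T : bounded_op T ->
  exists E, orthogonal_projection E /\ forall x, E x = 0 <-> T x = 0.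
Proof.
move=> bT.
have sK : subspace (Defs.kernel T).
  case: bT => lT _; have T0 : T 0 = 0.
    by have := lT (-1) 0 0; rewrite scaleN1r oppr0 addr0 scaleN1r addNr.
  split; first by exists 0.
  by move=> a x y; rewrite /Defs.kernel /= lT => -> ->; rewrite scaler0 addr0.
have cK : closed (Defs.kernel T).
  apply: (@closed_comp _ _ T [set 0]); first by move=> x _; exact: bT.2.
  exact/accessible_closed_set1/hausdorff_accessible/norm_hausdorff.
have [P [oP rP]] := orthogonal_projection_exists sK cK.
have bP : bounded_op P by case: oP.
have oE : orthogonal_projection (id \- P).
  have bE : bounded_op (id \- P) by apply: bounded_op_sub => //; exact: bounded_op_id.
  split=> //.
    apply/funext => x /=; have /bounded_op_linear[f _ fE] := bP.
    have := orthogonal_projectionK x oP; rewrite fE => ffx.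
    by rewrite (linearB f)/= ffx subrr subr0.
  apply: adjoint_unique => // x y /=.
  by rewrite innerBl innerBr orthogonal_projection_sym.
exists (id \- P); split=> // x /=; split=> [/subr0_eq xP|Tx].
  by rewrite -[T x = 0]/(Defs.kernel T x) -rP; exists x.
by rewrite (orthogonal_projection_range oP) ?subrr// rP.
Qed.

(** The vector [x - E x] is killed by [E], hence by [A]. *)
Lemma orthogonal_projection_comp E A x : orthogonal_projection E -> bounded_op A ->
  (forall y, E y = 0 -> A y = 0) -> A (E x) = A x.
Proof.
move=> oE /bounded_op_linear[f _ ->] EA; apply/eqP.
rewrite -subr_eq0 -(linearB f); apply/eqP/EA.
have [bE _ _] := oE; have /bounded_op_linear[g _ gE] := bE.
by rewrite gE (linearB g)/= -gE (orthogonal_projectionK _ oE) subrr.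
Qed.

(** The second identity is the adjoint of the first. *)
Lemma orthogonal_projection_le E Q x : orthogonal_projection E ->
  orthogonal_projection Q -> (forall y, E y = 0 -> Q y = 0) ->
  Q (E x) = Q x /\ E (Q x) = Q x.
Proof.
move=> oE oQ EQ; have QE y : Q (E y) = Q y.
  by apply: (orthogonal_projection_comp _ oE) => //; case: oQ.
split=> //; apply: innerI => y.
by rewrite -!orthogonal_projection_sym// QE.
Qed.

(** * Partial isometries, moduli and square roots *)

Lemma partial_isometry_projection U : partial_isometry U ->
  orthogonal_projection (adjoint U \o U) /\
  forall x, adjoint U (U x) = 0 <-> U x = 0.
Proof.
move=> [bU isoU]; have [E [oE EU]] := kernel_projection bU.
(* With [E] the projection along [N(U)], the quadratic forms agree: [<U^* U z, z> = |U (E z)|^2 = |E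
   z|^2 = <E z, z>]. *)
suff UE : adjoint U \o U = E by rewrite UE; split=> // x; rewrite -EU -UE.
apply/funext => x; apply/subr0_eq.
apply: (bounded_op_eq0 (A := (adjoint U \o U) \- E)).
  apply: bounded_op_sub; last by case: oE.
  exact/bounded_op_comp/bU/adjoint_bounded.
move=> z /=; rewrite innerBl adjointE'//.
have -> : U z = U (E z).
  by rewrite (orthogonal_projection_comp _ oE)// => y /EU.
rewrite -normr_inner isoU ?normr_inner.
  by rewrite -(orthogonal_projection_sym _ _ oE) orthogonal_projectionK// subrr.
move=> y /EU Ey0.
by rewrite (orthogonal_projection_sym _ _ oE) Ey0 linear0r.
Qed.

(** Indeed [|A x| = |T x|]. *)
Lemma modulus_kernel T A x : bounded_op T -> is_modulus T A ->
  A x = 0 <-> T x = 0.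
Proof.
move=> bT [pA AA].
have AT : '[A x, A x] = '[T x, T x].
  rewrite -positive_op_sym// -[in RHS]adjointE'//.
  by have /(congr1 (@^~ x)) /= -> := AA.
split=> e; apply/eqP; rewrite -(dnorm_eq0 (@inner R H)).
  by rewrite -AT e linear0l.
by rewrite AT e linear0l.
Qed.

(** Dual to the density of [R(A)] in the complement of [N(T)]: each [D^* y] is orthogonal to [R(A)],
    so it lies in [N(A) = N(T) = N(E)], whence [D E = 0], while [D = D E]. *)
Lemma polar_vanish T A D x : bounded_op T -> is_modulus T A -> bounded_op D ->
  (forall y, T y = 0 -> D y = 0) -> (forall y, D (A y) = 0) -> D x = 0.
Proof.
move=> bT mA bD TD DA; have [E [oE ET]] := kernel_projection bT.
apply: inner_eq0 => y.
rewrite -(orthogonal_projection_comp x oE bD) => [|z /ET /TD//].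
rewrite adjointE// orthogonal_projection_sym//.
suff -> : E (adjoint D y) = 0 by rewrite linear0r.
apply/ET/(modulus_kernel _ bT mA)/inner_eq0 => z.
by rewrite (positive_op_sym _ _ mA.1) adjointE'// DA linear0r.
Qed.

(* With [X = A Q - B] the hypotheses give [A X = - X B]. *)
Lemma positive_op_root_proj A B Q x : positive_op A -> positive_op B ->
  orthogonal_projection Q -> (forall y, B (Q y) = B y) ->
  (forall y, A (A (Q y)) = B (B y)) -> A (Q x) = B x.
Proof.
move=> pA pB oQ BQ AB; have [bQ _ _] := oQ.
have /bounded_op_linear[a _ aE] := pA.1.
have /bounded_op_linear[b _ bE] := pB.1.
have QB y : Q (B y) = B y.
  apply: innerI => z.
  by rewrite -orthogonal_projection_sym// -!positive_op_sym// BQ.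
pose X := (A \o Q) \- B.
have bX : bounded_op X.
  by apply: bounded_op_sub pB.1; exact: bounded_op_comp pA.1 bQ.
have XE y : X y = A (Q y) - B y by [].
have AX y : A (X y) = 0.
  apply: (sylvester_eq0 _ pA pB bX) => {}y.
  by rewrite !XE QB opprB aE (linearB a)/= -aE AB.
have ABB y : A (B y) = B (B y).
  by have := AX y; rewrite XE aE (linearB a)/= -aE AB => /subr0_eq.
(* The adjoint of [A B = B^2]. *)
have BA y : B (A y) = B (B y).
  by apply: innerI => z; rewrite -!positive_op_sym// ABB.
have BX y : B (X y) = 0.
  by rewrite XE bE (linearB b)/= -bE BA BQ subrr.
(* Now [|X x|^2 = <Q x, A (X x)> - <x, B (X x)> = 0]. *)
apply/subr0_eq; rewrite -XE; apply/eqP; rewrite -(dnorm_eq0 (@inner R H)).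
rewrite {1}XE innerBl (positive_op_sym _ _ pA) (positive_op_sym _ _ pB) AX BX.
by rewrite !linear0r subrr.
Qed.

(** * Inverses and spectra *)

Lemma bounded_below_inverse L (c : R[i]) : bounded_op L -> 0 < c ->
  (forall x, c * `|x| <= `|L x|) -> (forall x, adjoint L x = 0 -> x = 0) ->
  exists2 B, bounded_op B & B \o L = id /\ L \o B = id.
Proof.
move=> bL c0 cL kL; have /bounded_op_linear[f cf fE] := bL.
have cLx x y : `|x - y| <= c^-1 * `|L x - L y|.
  by rewrite ler_pdivlMl// (le_trans (cL _))// fE (linearB f).
have sR := range_subspace bL.
(* Preimages of points approaching [p] form a Cauchy sequence because [L] is bounded below. *)
have cR : closed (range L).
  move=> p clp.
  have /choice[u up] : forall k : nat, exists x, `|L x - p| < k.+1%:R^-1.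
    move=> k; have k0 : (0 : R[i]) < k.+1%:R^-1 by rewrite invr_gt0 ltr0Sn.
    have [_ [[x _ <-]]] := clp _ (nbhsx_ballx p _ k0).
    by rewrite -ball_normE/= distrC; exists x.
  have [||x ux] := @cvg_of_dist u c^-1.
  - by rewrite invr_gt0.
  - move=> j k; rewrite (le_trans (cLx _ _))// ler_wpM2l ?invr_ge0 ?(ltW c0)//.
    by rewrite (le_trans (ler_distD p _ _))// lerD// ltW// distrC.
  exists x => //; apply: (@cvg_unique _ (@norm_hausdorff _ H) (L \o u @ \oo)).
    by apply: continuous_cvg => //; exact: bL.2.
  apply/cvgrPdist_lt => e e0; near=> k.
  rewrite distrC (lt_trans (up k))//; near: k; exact: near_natSinv_lt.
(* The residue of [y] after projection onto the range is orthogonal to the range, so [L^*] kills it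
   and it is zero. *)
have /choice[B LB] : forall y, exists x, L x = y.
  move=> y; have [m [x _ <-] orth] := projection_theorem y sR cR.
  exists x; apply/esym/subr0_eq/kL/inner_eq0 => z.
  by rewrite adjointE'//; apply: orth; exists z.
have Linj x y : L x = L y -> x = y.
  move=> Lxy; apply/subr0_eq/eqP; rewrite -normr_le0.
  by rewrite (le_trans (cLx _ _))// Lxy subrr normr0 mulr0.
exists B; last by split; apply/funext => x //=; exact: Linj.
apply: (@bound_bounded_op _ c^-1) => [a x y|x].
  by apply: Linj; rewrite fE linearP -fE !LB.
by rewrite ler_pdivlMl// (le_trans (cL _))// LB.
Unshelve. all: by end_near. Qed.

(** Let [c] and [d] bound [A] and [A^*]. If [|l| > c + d], then [l - A] is bounded below by
    [|l| - c], and its adjoint is injective since [|l| > d]; hence [l - A] is invertible. *)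
Lemma spectrum_bounded A : bounded_op A ->
  exists c : R[i], forall l, spectrum A l -> `|l| <= c.
Proof.
move=> bA; have [c c0 cA] := bounded_op_bound bA.
have [d d0 dA] := bounded_op_bound (adjoint_bounded bA).
exists (c + d) => l; apply: contra_notP => /negP lcd.
have {}lcd : c + d < `|l| by rewrite real_ltNge// ger0_real// addr_ge0 ?ltW.
have bL : bounded_op (l \*: id \- A).
  apply: bounded_op_sub => //; have := bounded_op_lin l 0 bounded_op_id bounded_op_id.
  by congr bounded_op; apply/funext => x /=; rewrite scale0r addr0.
have lc : 0 < `|l| - c by rewrite subr_gt0 (lt_trans _ lcd)// ltrDl.
apply: (bounded_below_inverse bL lc) => x.
  rewrite /= mulrBl -normrZ lerBlDr -{1}(subrK (A x) (l *: x)).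
  by rewrite (le_trans (ler_normD _ _))// lerD2l.
move=> Lx; have lx : l^* *: x = adjoint A x.
  apply: innerI => y; rewrite innerZr conjCK -adjointE//.
  have := adjointE y x bL; rewrite Lx linear0r /= innerBl innerZl.
  exact: subr0_eq.
apply/eqP; apply: contraTT (dA x) => x0.
rewrite -lx normrZ norm_conjC -real_ltNge ?ger0_real ?mulr_ge0 ?(ltW d0)//.
by rewrite ltr_pM2r ?normr_gt0// (lt_trans _ lcd)// ltrDr.
Qed.

(** Relative to [Q], the operator [l - A Q] is block diagonal with blocks [l - A] and [l]. For
    nonzero [l], its inverse is [B Q + l^-1 (1 - Q)], where [B] inverts [l - A]. *)
Lemma spectrum_comp_projection A Q l : bounded_op A -> orthogonal_projection Q ->
  (forall x, Q (A x) = A (Q x)) -> spectrum (A \o Q) l -> l = 0 \/ spectrum A l.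
Proof.
move=> bA oQ QA; apply: contraPP => /not_orP[/eqP l0 /contrapT[B bB [BL LB]]].
apply; have bQ : bounded_op Q by case: oQ.
have /bounded_op_linear[q _ qE] := bQ.
have LBE x : l *: B x - A (B x) = x by have /(congr1 (@^~ x)) := LB.
have BLE x : B (l *: x - A x) = x by have /(congr1 (@^~ x)) := BL.
have QBQ x : Q (B (Q x)) = B (Q x).
  rewrite -[LHS]BLE -QA qE -(linearZ_LR q) -(linearB q) -qE LBE.
  by rewrite orthogonal_projectionK.
exists (fun x => B (Q x) + l^-1 *: (x - Q x)).
  have := bounded_op_lin 1 l^-1 (bounded_op_comp bB bQ)
    (bounded_op_sub bounded_op_id bQ).
  by congr bounded_op; apply/funext => x; rewrite scale1r.
split; apply/funext => x /=.
  have QL : Q (l *: x - A (Q x)) = l *: Q x - A (Q x).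
    by rewrite qE (linearB q) (linearZ_LR q)/= -qE QA orthogonal_projectionK.
  by rewrite QL BLE opprB addrA subrK -scalerBr scalerA mulVf// scale1r addrC subrK.
have -> : Q (B (Q x) + l^-1 *: (x - Q x)) = B (Q x).
  rewrite qE (linearD q) (linearZ_LR q) (linearB q)/= -qE QBQ.
  by rewrite orthogonal_projectionK// subrr scaler0 addr0.
by rewrite scalerDr scalerA mulfV// scale1r addrAC LBE addrC subrK.
Qed.

(** The extra point 0 is harmless: a supremum of moduli is nonnegative, also over the empty set,
    where [sup] is 0. Boundedness of [A] makes its [sup] an actual upper bound. *)
Lemma spectral_radius_le A B : bounded_op A ->
  (forall l, spectrum B l -> l = 0 \/ spectrum A l) ->
  spectral_radius B <= spectral_radius A.
Proof.
move=> bA BA; have [c cA] := spectrum_bounded bA.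
pose r (T : H -> H) := [set complex.Re `|l| | l in spectrum T].
have r_ge0 (l : R[i]) : 0 <= complex.Re `|l|.
  by have : 0 <= `|l| by []; rewrite lecE => /andP[].
have ub l : spectrum A l -> complex.Re `|l| <= sup (r A).
  move=> Al; apply: ub_le_sup; last by exists l.
  exists (complex.Re c) => _ [k /cA + <-].
  by rewrite lecE => /andP[].
have sA : 0 <= sup (r A).
  have [->|/set0P[_ [l Al _]]] := eqVneq (r A) set0; first by rewrite sup0.
  exact: le_trans (r_ge0 l) (ub _ Al).
rewrite /spectral_radius -/(r A) -/(r B).
have [->|/set0P B0] := eqVneq (r B) set0; first by rewrite sup0.
apply: ge_sup => // _ [l /BA[->|Al] <-]; last exact: ub.
by rewrite normr0.
Qed.

(** * Consequences of the star order *)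

Lemma star_le_proj S T P x : star_le S T -> orthogonal_projection P ->
  range P = range S -> P (T x) = S x.
Proof.
move=> [P' [_ [oP' _ SE _]]] oP rP.
(* The projection [P'] supplied by the order may be larger than [P], but its range contains [R(S)];
   thus [P' P = P], and by adjoints [P P' = P]. *)
have P'P y : P' (P y) = P y.
  have : range S (P y) by rewrite -rP; exists y.
  by move=> [z _ <-]; rewrite SE /= orthogonal_projectionK.
have PP' y : P (P' y) = P y.
  apply: innerI => z; rewrite -(orthogonal_projection_sym _ _ oP).
  rewrite -(orthogonal_projection_sym _ _ oP') P'P.
  by rewrite (orthogonal_projection_sym _ _ oP).
have -> : S x = P (S x).
  by rewrite (orthogonal_projection_range oP)// rP; exists x.
by rewrite SE /= PP'.
Qed.

(** Taking adjoints in [S^* = Q' T^*] gives [S = T Q']. Then [N(Q')] lies in [N(S) = N(Q)], so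
    [Q' Q = Q] and [T Q = T Q' Q = S Q = S]. *)
Lemma star_le_initial S T Q x : bounded_op S -> bounded_op T -> star_le S T ->
  orthogonal_projection Q -> (forall y, Q y = 0 <-> S y = 0) -> T (Q x) = S x.
Proof.
move=> bS bT [_ [Q' [_ oQ' _ SE]]] oQ QS.
have TQ' y : S y = T (Q' y).
  apply: innerI => z; rewrite -(adjointE' _ _ bS) SE /=.
  by rewrite (orthogonal_projection_sym _ _ oQ') adjointE'.
have T0 : T 0 = 0 by have /bounded_op_linear[f _ ->] := bT; rewrite linear0.
have Q'Q y : Q' y = 0 -> Q y = 0 by move=> Q'y; apply/QS; rewrite TQ' Q'y T0.
have [_ <-] := orthogonal_projection_le x oQ' oQ Q'Q.
by rewrite -TQ' (orthogonal_projection_comp _ oQ)// => y /QS.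
Qed.

(** [A U^* U = A] because [U] and [A] have the same kernel; the adjoint identity [U^* U A = A] is
    the claim. *)
Lemma polar_modulusE T U A x : partial_isometry U ->
  (forall y, U y = 0 <-> T y = 0) -> bounded_op T -> is_modulus T A ->
  T = U \o A -> adjoint U (T x) = A x.
Proof.
move=> pU UT bT mA TE; have [oE EU] := partial_isometry_projection pU.
have pA := mA.1.
have AE y : A (adjoint U (U y)) = A y.
  apply: (orthogonal_projection_comp _ oE) => [|z /EU /UT]; first exact: pA.1.
  by move/(modulus_kernel _ bT mA).
rewrite TE /=; apply: innerI => z; rewrite -[LHS](orthogonal_projection_sym _ _ oE).
by rewrite -!(positive_op_sym _ _ pA) AE.
Qed.

End hilbert_space.

Theorem theorem4p4 (R : realType) (H : hilbertType R)
    (S T US W UT V : H -> H)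
    (S_bounded : bounded_op S) (T_bounded : bounded_op T)
    (S_closed : closed (range S)) (T_closed : closed (range T))
    (S_le_T : star_le S T)
    (S_splitting : polar_proper_splitting S US W)
    (T_splitting : polar_proper_splitting T UT V) :
  [/\ splitting_converges UT V -> splitting_converges US W,
      spectral_radius (adjoint US \o W) <= spectral_radius (adjoint UT \o V),
      S = (proj_onto (range S) \o UT) \- (proj_onto (range S) \o V),
      US = proj_onto (range S) \o UT
    & W = proj_onto (range S) \o V].
Proof.
have [[pUS kUS [AS mAS SE]] WE] := S_splitting.
have [[pUT kUT [AT mAT TE]] VE] := T_splitting.
have kS y : US y = 0 <-> S y = 0 by rewrite -[US y = 0]/(Defs.kernel US y) kUS.
have kT y : UT y = 0 <-> T y = 0 by rewrite -[UT y = 0]/(Defs.kernel UT y) kUT.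
have [bUS _] := pUS; have [bUT _] := pUT.
have [oP rP] := proj_ontoP S_bounded S_closed.
set P := proj_onto (range S) in oP rP *.
have [oQ QUS] := partial_isometry_projection pUS.
have [oE EUT] := partial_isometry_projection pUT.
set Q := adjoint US \o US in oQ; set E := adjoint UT \o UT in oE.
have QS y : Q y = 0 <-> S y = 0 by rewrite -kS; exact: QUS.
have ET y : E y = 0 <-> T y = 0 by rewrite -kT; exact: EUT.
have [bP _ _] := oP; have [bQ _ _] := oQ.
have PT x : P (T x) = S x by exact: star_le_proj.
have TQ x : T (Q x) = S x by exact: star_le_initial.
have /bounded_op_linear[p _ pE] := bP.
have /bounded_op_linear[q _ qE] := bQ.
have /bounded_op_linear[ut _ utE] := bUT.
have [pAS AAS] := mAS; have [pAT AAT] := mAT.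
have ASE y : AS (AS y) = adjoint S (S y) by have /(congr1 (@^~ y)) := AAS.
have ATE y : AT (AT y) = adjoint T (T y) by have /(congr1 (@^~ y)) := AAT.
have ASQ x : AS (Q x) = AS x.
  apply: (orthogonal_projection_comp _ oQ) pAS.1 _ => y /QS.
  by move/(modulus_kernel _ S_bounded mAS).
have ATQ x : AT (Q x) = AS x.
  apply: (positive_op_root_proj _ pAT pAS oQ ASQ) => y.
  (* It remains to see [T^* S = S^* S]: [<T z, S y> = <T z, P (S y)> = <S z, S y>]. *)
  rewrite ATE ASE TQ; apply: innerI => z.
  rewrite -!adjointE// -(PT z) (orthogonal_projection_sym _ _ oP).
  by rewrite (orthogonal_projection_range oP)// rP; exists y.
have QAT x : Q (AT x) = AS x.
  apply: innerI => z; rewrite -(orthogonal_projection_sym _ _ oQ).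
  by rewrite -(positive_op_sym _ _ pAT) -(positive_op_sym _ _ pAS) ATQ.
(* [U_S |T| = U_S Q |T| = U_S |S| = S]. *)
have USAT x : US (AT x) = S x.
  rewrite -(orthogonal_projection_comp _ oQ bUS) => [|y /QS /kS//].
  by rewrite QAT SE.
(* Both sides vanish on [N(S)], and on [R(|S|)] both give [S], as [U_T Q |S| = U_T |T| Q = T Q]. *)
have UTQ x : UT (Q x) = US x.
  apply/subr0_eq; apply: (polar_vanish (D := (UT \o Q) \- US) _ S_bounded mAS).
  - by apply: bounded_op_sub => //; exact: bounded_op_comp.
  - move=> y Sy /=; move/QS : (Sy) => ->; move/kS : Sy => ->.
    by rewrite utE linear0 subrr.
  - move=> y /=; have -> : Q (AS y) = AS y by rewrite -QAT orthogonal_projectionK.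
    rewrite -[US _]/((US \o AS) y) -SE -ATQ.
    by rewrite -[UT _]/((UT \o AT) (Q y)) -TE TQ subrr.
(* Both sides vanish on [N(T)], and on [R(|T|)] both give [S], as [P U_T |T| = P T]. *)
have PUT x : P (UT x) = US x.
  apply/subr0_eq; apply: (polar_vanish (D := (P \o UT) \- US) _ T_bounded mAT).
  - by apply: bounded_op_sub => //; exact: bounded_op_comp.
  - move=> y Ty /=; move/kT : (Ty) => ->.
    have -> : US y = 0 by apply/kS; rewrite -PT Ty pE linear0.
    by rewrite pE linear0 subrr.
  - by move=> y /=; rewrite USAT -[UT (AT y)]/((UT \o AT) y) -TE PT subrr.
have PV x : P (V x) = W x by rewrite VE WE /= pE (linearB p) -pE PUT PT.
have rad : spectral_radius (adjoint US \o W) <= spectral_radius (adjoint UT \o V).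
  have bM : bounded_op (adjoint UT \o V).
    apply: bounded_op_comp; first exact: adjoint_bounded.
    by rewrite VE; exact: bounded_op_sub.
  have /bounded_op_linear[a _ aE] := adjoint_bounded bUT.
  have ME x : adjoint UT (V x) = E x - AT x.
    by rewrite VE /= aE (linearB a) -aE (polar_modulusE _ pUT kT T_bounded mAT TE).
  (* [N(T)] lies in [N(S)], so the initial projection [Q] of [U_S] lies below that of [U_T]. *)
  have QE x : Q (E x) = Q x /\ E (Q x) = Q x.
    apply: orthogonal_projection_le => // y /ET Ty.
    by apply/QS; rewrite -PT Ty pE linear0.
  have QM x : Q (adjoint UT (V x)) = adjoint UT (V (Q x)).
    by rewrite !ME qE (linearB q) -qE QAT ATQ (QE x).1 (QE x).2.
  (* Both sides equal [Q - |S|]. *)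
  have -> : adjoint US \o W = (adjoint UT \o V) \o Q.
    apply/funext => x; rewrite [RHS]/= -QM ME qE (linearB q)/= -qE (QE x).1 QAT.
    have /bounded_op_linear[b _ bE] := adjoint_bounded bUS.
    rewrite WE /= bE (linearB b) -bE.
    by rewrite (polar_modulusE _ pUS kS S_bounded mAS SE).
  by apply: spectral_radius_le => // l; apply: spectrum_comp_projection.
split=> //; first exact: le_lt_trans.
- by apply/funext => x /=; rewrite PUT PV WE /= opprB addrC subrK.
- by apply/funext => x /=; rewrite PUT.
- by apply/funext => x /=; rewrite PV.
Qed.
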